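(* Let $n\ge 2$, $k\ge1$ be integers and $0<q<p<1$. For any $0<r<1$ and any integer $D\ge1$, if $$\frac{(p-q)^2}{q(1-p)}\le\frac{r}{(D(D+1))^2}\left(\frac{k^2}{n}\wedge 1\right),$$ then $$\inf_{\widehat M\in\mathbb R[A]^{n\times n}_{\le D}}\mathbb E_{A,\,M\sim\mathbb P_{\mathrm{SBM}(p,q)}}\big(\ell(\widehat M,M)\big)\ \ge\ \frac{(p-q)^2}{k}-(p-q)^2\left(\frac1{k^2}+\frac{r(2-r)}{(1-r)^2n}\right).$$
   Context: The prior $\mathbb P_{\mathrm{SBM}(p,q)}$ on $n\times n$ matrices: sample $z\in[k]^n$ with $z_i$ i.i.d. uniform on $\{1,\dots,k\}$; set $M_{ii}=0$ and $M_{ij}=M_{ji}=p\,\mathbf 1(z_i=z_j)+q\,\mathbf 1(z_i\ne z_j)$ for $i\neq j$. Given $M$, one observes a symmetric $A\in\{0,1\}^{n\times n}$ with $A_{ii}=0$ and $A_{ij}=A_{ji}\sim\mathrm{Bernoulli}(M_{ij})$ independent over $1\le i<j\le n$. The expectation is over both $M$ and $A$. The loss is $\ell(\widehat M,M)=\binom n2^{-1}\sum_{1\le i<j\le n}(\widehat M_{ij}-M_{ij})^2$. The notation $\widehat M\in\mathbb R[A]^{n\times n}_{\le D}$ means every entry $\widehat M_{ij}$ is a real polynomial of degree at most $D$ in the entries of $A$. $a\wedge b=\min(a,b)$. *)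

(* Defs.v *)
From mathcomp Require Import all_boot all_order all_algebra.
From mathcomp Require Import classical_sets reals bernoulli_distribution.
From mathcomp Require Import mpoly.

Set Implicit Arguments.
Unset Strict Implicit.
Unset Printing Implicit Defensive.

Import Order.TTheory GRing.Theory Num.Theory.
Local Open Scope ring_scope.
Local Open Scope classical_set_scope.

Definition uniform_labels_pmf (R : realType) (n k : nat)
    (z : {ffun 'I_n -> 'I_k}) : R :=
  \prod_(i < n) k%:R^-1.

Definition sbm_mean (R : realType) (n k : nat) (p q : R)
    (z : {ffun 'I_n -> 'I_k}) : 'M[R]_n :=
  \matrix_(i, j) if i == j then 0 else if z i == z j then p else q.

(* Law of A given M on all Boolean matrices: it is carried by the symmetric
   matrices with zero diagonal, whose entries above the diagonal are
   independent. *)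
Definition adjacency_pmf (R : realType) (n : nat) (M : 'M[R]_n)
    (A : 'M[bool]_n) : R :=
  if (A^T == A) && [forall i, ~~ A i i]
  then \prod_(i < n) \prod_(j < n | (i < j)%N) bernoulli_pmf (M i j) (A i j)
  else 0.

Definition sbm_expectation (R : realType) (n k : nat) (p q : R)
    (f : 'M[R]_n -> 'M[bool]_n -> R) : R :=
  \sum_(z : {ffun 'I_n -> 'I_k}) uniform_labels_pmf R z *
    \sum_(A : 'M[bool]_n)
      adjacency_pmf (sbm_mean p q z) A * f (sbm_mean p q z) A.

Definition loss (R : realType) (n : nat) (Mhat M : 'M[R]_n) : R :=
  'C(n, 2)%:R^-1 *
    \sum_(i < n) \sum_(j < n | (i < j)%N) (Mhat i j - M i j) ^+ 2.

(* The variable of index [mxvec_index i j] stands for the entry [A i j]. *)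
Definition poly_estimate (R : realType) (n : nat)
    (P : 'M[{mpoly R[n * n]}]_n) (A : 'M[bool]_n) : 'M[R]_n :=
  map_mx (meval (mxvec (map_mx (fun b : bool => b%:R) A) 0)) P.

(* [msize] is the total degree plus one, and zero for the zero polynomial. *)
Definition poly_estimators (R : realType) (n D : nat) :
    set 'M[{mpoly R[n * n]}]_n :=
  [set P | forall i j, (msize (P i j) <= D.+1)%N].

Definition sbm_risk (R : realType) (n k : nat) (p q : R)
    (P : 'M[{mpoly R[n * n]}]_n) : R :=
  sbm_expectation k p q (fun M A => loss (poly_estimate P A) M).

(* Main.v *)
(* Realise each edge of A from noise s_e that, with probabilities q, 1-p, p-q,
   forces A_e = 1, forces A_e = 0, or sets A_e to the community indicator of e.
   Let x = M_ij - q. If a function G of s alone satisfies E[f(A) G] = E[f(A) x]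
   for every f of degree at most D, then E(f - x)^2 >= E x^2 - E G^2 for these f.
   Expanding G in products over edge sets a, |a| <= D, of a score that has mean
   zero and covariance 1 with A_e, the coefficients are forced: they are
   (p-q)^(|a|+1) times the joint cumulants kappa_a of the community indicators of
   {i, j} and of the edges of a.
   Uniform labels make kappa_a vanish unless a is connected and joins i to j,
   while |kappa_a| <= (|a|+1)^|a| k^(1-v) when a spans v vertices. Counting such
   graphs and summing over v and |a| bounds the part of E G^2 with a nonempty by
   (p-q)^2 sum_(d >= 1) (d+1) r^d / n. *)
From HB Require Import structures.
Require Import Defs.
From mathcomp Require Import classical_sets reals bernoulli_distribution.
From mathcomp Require Import all_boot all_order all_algebra all_fingroup.
From mathcomp Require Import mpoly ring lra zify.
Set Implicit Arguments.
Unset Strict Implicit.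
Unset Printing Implicit Defensive.
Import Order.TTheory GRing.Theory Num.Theory.
Local Open Scope ring_scope.

(** * Expansion of a product of sums over subsets *)

Lemma prodrD_subset (R : comPzSemiRingType) (E : finType) (T : {set E})
    (F G : E -> R) :
  \prod_(e in T) (F e + G e)
    = \sum_(b : {set E} | b \subset T)
        (\prod_(e in b) F e) * \prod_(e in T :\: b) G e.
Proof.
have -> : \prod_(e in T) (F e + G e)
    = \prod_e ((if e \in T then F e else 0) + (if e \in T then G e else 1)).
  by rewrite big_mkcond; apply: eq_bigr => e _; case: ifP; rewrite ?add0r.
rewrite bigA_distr (bigID (fun b : {set E} => b \subset T)) /=.
rewrite [X in _ + X]big1 ?addr0 => [|b nbT]; last first.
  have [e eb neT] := subsetPn nbT.
  by rewrite (bigD1 e) //= eb (negbTE neT) mul0r.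
apply: eq_bigr => b /subsetP bT.
rewrite (bigID (fun e => e \in b)) /=; congr (_ * _).
  by apply: eq_bigr => e eb; rewrite eb bT.
rewrite big_mkcond [RHS]big_mkcond; apply: eq_bigr => e _ /=.
by rewrite in_setD; case: (e \in b).
Qed.

(** * Joint cumulants *)

Section Cumulant.
Variables (R : realFieldType) (E : finType).
Implicit Types (m c kap : {set E} -> R) (a b g : {set E}).

(** Read [m b] as the mean of the product of Y_e over b, and [c b] as the same mean with an extra
    factor X. This is the moment-cumulant formula sorted by the block of X, so [kap a] is the joint
    cumulant of X and the Y_e with e in a. *)
Definition is_cumulant m c kap :=
  forall b, c b = \sum_(a : {set E} | a \subset b) kap a * m (b :\: a).

(** The system is triangular in [#|b|] with diagonal [m set0 = 1], so it is solved one cardinality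
    at a time. *)
Lemma cumulant_exists m c : m set0 = 1 -> exists kap, is_cumulant m c kap.
Proof.
move=> m0.
suff /(_ #|E|.+1)[kap hkap] : forall N, exists kap : {set E} -> R,
    forall b, (#|b| < N)%N ->
      c b = \sum_(a : {set E} | a \subset b) kap a * m (b :\: a).
  by exists kap => b; apply: hkap; rewrite ltnS max_card.
elim=> [|N [kap hkap]]; first by exists (fun=> 0).
pose kap' b := if #|b| == N
  then c b - \sum_(a : {set E} | a \proper b) kap a * m (b :\: a) else kap b.
exists kap' => b; rewrite ltnS (bigD1 b) //= setDv m0 mulr1 => leN.
have eqsum : \sum_(a : {set E} | (a \subset b) && (a != b)) kap' a * m (b :\: a)
    = \sum_(a : {set E} | a \proper b) kap a * m (b :\: a).
  apply: eq_big => [a|a /andP[ab nab]]; first by rewrite properEneq andbC.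
  rewrite /kap' ltn_eqF // (leq_trans _ leN) // proper_card //.
  by rewrite properEneq nab ab.
rewrite eqsum {1}/kap'; case: eqP => [_|/eqP nN]; first by rewrite subrK.
rewrite hkap ?ltn_neqAle ?nN // (bigD1 b) //= setDv m0 mulr1; congr (_ + _).
by apply: eq_bigl => a; rewrite properEneq andbC.
Qed.

(* If the edges of [a] outside [a1] are independent of everything else, a joint
   cumulant that involves one of them is zero. *)
Lemma cumulant_eq0 m c kap a a1 :
    m set0 = 1 -> is_cumulant m c kap ->
    {in [pred b : {set E} | b \subset a], forall b,
       m b = m (b :&: a1) * m (b :\: a1)} ->
    {in [pred b : {set E} | b \subset a], forall b,
       c b = c (b :&: a1) * m (b :\: a1)} ->
  ~~ (a \subset a1) -> kap a = 0.
Proof.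
move=> m0 hk hm hc.
suff: forall N b, (#|b| < N)%N -> b \subset a -> ~~ (b \subset a1) -> kap b = 0.
  by move/(_ #|a|.+1 a); apply.
elim=> // N IHN b; rewrite ltnS => leN ba nba1.
(* In the recursion for [c b], the terms g other than b that are not inside [a1] vanish by
   induction. Those inside [a1] recombine to [c (b :&: a1) * m (b :\: a1)], which is [c b]; what is
   left over is [kap b]. *)
have: c b = c b + kap b.
  rewrite {1}hk (bigD1 b) //= setDv m0 mulr1 addrC; congr (_ + _).
  rewrite (bigID (fun g => g \subset a1)) /= [X in _ + X]big1 ?addr0; last first.
    move=> g /andP[/andP[gb neq] ng]; rewrite IHN ?mul0r //.
      by rewrite (leq_trans _ leN) // proper_card // properEneq neq.
    exact: subset_trans ba.
  rewrite hc // hk big_distrl /=.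
  apply: eq_big => [g|g /andP[/andP[gb neq] ga1]].
    rewrite subsetI -andbA; case gb: (g \subset b) => //=.
    case ga1: (g \subset a1); rewrite ?andbF ?andbT //=.
    by apply: contraNneq nba1 => <-.
  rewrite -mulrA hm /= ?inE ?(subset_trans (subsetDl _ _)) //.
  congr (_ * (m _ * m _)); first by rewrite setIDAC.
  by rewrite setDDl (setUidPr ga1).
by rewrite -{1}[c b]addr0 => /addrI.
Qed.

Lemma sum_subset_expr a (x : R) :
  \sum_(b : {set E} | b \subset a) x ^+ #|b| = (x + 1) ^+ #|a|.
Proof.
rewrite -[RHS]prodr_const prodrD_subset.
by apply: eq_bigr => b _; rewrite prodr_const big1_eq mulr1.
Qed.

(** Induction on [#|a|]: a proper subset b has |b| + 1 <= |a|, and supermultiplicativity pulls out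
    the factor [m a]. For nonempty a, the remaining 1 + sum of |a|^|b| over proper b is at most the
    sum over all b, which is (|a| + 1)^|a|. *)
Lemma cumulant_bound m c kap :
    m set0 = 1 -> is_cumulant m c kap -> (forall a, 0 <= m a) ->
    (forall a, 0 <= c a <= m a) ->
    (forall a b, b \subset a -> m b * m (a :\: b) <= m a) ->
  forall a, `|kap a| <= (#|a|.+1%:R) ^+ #|a| * m a.
Proof.
move=> m0 hk mge0 hc mM a.
have [N] := ubnP #|a|; elim: N a => // N IHN a; rewrite ltnS => leN.
have -> : kap a
    = c a - \sum_(b : {set E} | b \proper a) kap b * m (a :\: b).
  rewrite hk (bigD1 a) //= setDv m0 mulr1 -addrA.
  rewrite (eq_bigl (fun b => b \proper a)) ?subrr ?addr0 // => b.
  by rewrite properEneq andbC.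
have [a0|ane] := eqVneq #|a| 0%N.
  rewrite a0 expr0 mul1r big1 ?subr0 => [|b].
    by case/andP: (hc a) => /ger0_norm->.
  by move/proper_card; rewrite a0.
have bnd : `|\sum_(b : {set E} | b \proper a) kap b * m (a :\: b)|
    <= (\sum_(b : {set E} | b \proper a) #|a|%:R ^+ #|b|) * m a.
  rewrite (le_trans (ler_norm_sum _ _ _)) // big_distrl ler_sum //= => b ba.
  rewrite normrM (ger0_norm (mge0 _)).
  have ltba := proper_card ba.
  rewrite (@le_trans _ _ ((#|b|.+1%:R) ^+ #|b| * m b * m (a :\: b))) //.
    by rewrite ler_wpM2r // IHN // (leq_trans ltba).
  rewrite -mulrA ler_pM ?mulr_ge0 ?exprn_ge0 // ?mM ?proper_sub //.
  by rewrite lerXn2r ?nnegrE // ler_nat.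
rewrite (le_trans (ler_normB _ _)) //.
case/andP: (hc a) => cge0 cle.
rewrite (le_trans (lerD _ bnd) (y := m a + _)) ?ger0_norm //.
rewrite -{1}[m a]mul1r -mulrDl ler_wpM2r //.
have := sum_subset_expr a #|a|%:R; rewrite (bigD1 a) //= -natr1 => <-.
rewrite [X in _ <= _ + X](eq_bigl (fun b => b \proper a)) => [|b]; last first.
  by rewrite properEneq andbC.
by rewrite -natrX lerD2r ler1n expn_gt0 lt0n ane.
Qed.

End Cumulant.

(** * Labelings constant along edges *)

(* Labels are added modulo [k.+1], so that the labelings constant along every edge
   of a set form a subgroup and [mul_cardG] compares their numbers. *)
Definition coloring (V : finType) (k : nat) := {ffun V -> 'I_k.+1}.

HB.instance Definition _ (V : finType) (k : nat) := Finite.on (coloring V k).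
HB.instance Definition _ (V : finType) (k : nat) :=
  GRing.Zmodule.on (coloring V k).
HB.instance Definition _ (V : finType) (k : nat) :=
  Finite_isGroup.Build (coloring V k) (@addrA _) (@add0r _) (@addNr _).

Lemma coloringM (V : finType) (k : nat) (x y : coloring V k) (i : V) :
  (x * y)%g i = x i + y i.
Proof. exact: ffunE. Qed.

Section Graph.
Variables (V E : finType) (src tgt : E -> V).
Implicit Types (k : nat) (S T : {set E}).

Definition mono k S : {set coloring V k} :=
  [set x : coloring V k | [forall e in S, x (src e) == x (tgt e)]].

Lemma monoP k S (x : coloring V k) :
  reflect (forall e, e \in S -> x (src e) = x (tgt e)) (x \in mono k S).
Proof.
rewrite inE; apply: (iffP forall_inP) => h e eS; first exact/eqP/h.
by apply/eqP/h.
Qed.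

Lemma mono_group_set k S : group_set (mono k S).
Proof.
apply/group_setP; split; first by apply/monoP => e _; rewrite !ffunE.
move=> x y /monoP hx /monoP hy; apply/monoP => e eS.
by rewrite !coloringM hx ?hy.
Qed.

Canonical mono_group k S := group (mono_group_set k S).

Lemma monoU k S T : mono k (S :|: T) = mono k S :&: mono k T.
Proof.
apply/setP => x; rewrite in_setI; apply/monoP/andP => [h|[/monoP hS /monoP hT] e].
  by split; apply/monoP => e he; apply: h; rewrite inE he ?orbT.
by rewrite inE => /orP[/hS|/hT].
Qed.

Variable R : realFieldType.

Definition monoProb k S : R := #|mono k S|%:R / #|coloring V k|%:R.

Lemma card_coloring_gt0 k : 0 < #|coloring V k|%:R :> R.
Proof. by rewrite ltr0n; apply/card_gt0P; exists 0. Qed.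

Lemma monoProb_ge0 k S : 0 <= monoProb k S.
Proof. by rewrite divr_ge0. Qed.

Lemma monoProb0 k : monoProb k set0 = 1.
Proof.
rewrite /monoProb; have -> : mono k set0 = setT.
  by apply/setP => x; rewrite [RHS]inE; apply/monoP => e; rewrite inE.
by rewrite cardsT divff // gt_eqF // card_coloring_gt0.
Qed.

Lemma monoProb_anti k S T : S \subset T -> monoProb k T <= monoProb k S.
Proof.
move=> sST; rewrite ler_pM2r ?invr_gt0 ?card_coloring_gt0 // ler_nat.
by rewrite subset_leq_card // -(setUidPr sST) monoU subsetIl.
Qed.

(** This is |H||K| = |HK||H :&: K| for two subgroups. The first factor on the right is at most 1,
    and is 1 when every labeling splits along the two subgroups: hence supermultiplicativity in
    general and independence in the split case. *)
Lemma monoProbM k S T :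
  monoProb k S * monoProb k T
    = #|(mono k S * mono k T)%g|%:R / #|coloring V k|%:R
      * monoProb k (S :|: T).
Proof.
by rewrite /monoProb mulrACA -natrM mul_cardG monoU natrM mulrACA.
Qed.

Lemma monoProb_superM k S T :
  monoProb k S * monoProb k T <= monoProb k (S :|: T).
Proof.
rewrite monoProbM ler_piMl ?monoProb_ge0 //.
by rewrite ler_pdivrMr ?card_coloring_gt0 // mul1r ler_nat max_card.
Qed.

Lemma monoProb_indep k S T :
    (forall x : coloring V k, exists2 y, y \in mono k S & x - y \in mono k T) ->
  monoProb k (S :|: T) = monoProb k S * monoProb k T.
Proof.
move=> dec; rewrite monoProbM.
have -> : (mono k S * mono k T)%g = setT.
  apply/setP => x; rewrite [RHS]inE; have [y yS xyT] := dec x.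
  by apply/mulsgP; exists y (x - y) => //; rewrite [RHS]addrC subrK.
by rewrite cardsT divff ?mul1r // gt_eqF // card_coloring_gt0.
Qed.

Definition supported k (C : {set V}) : {set coloring V k} :=
  [set x : coloring V k | [forall i, (i \notin C) ==> (x i == 0)]].

Lemma supportedP k (C : {set V}) (x : coloring V k) :
  reflect (forall i, i \notin C -> x i = 0) (x \in supported k C).
Proof.
rewrite inE; apply: (iffP forallP) => h i; first by move/(implyP (h i))/eqP.
by apply/implyP => /h/eqP.
Qed.

Lemma supported_group_set k C : group_set (supported k C).
Proof.
apply/group_setP; split; first by apply/supportedP => i _; rewrite ffunE.
move=> x y /supportedP hx /supportedP hy; apply/supportedP => i iC.
by rewrite coloringM hx // hy // addr0.
Qed.

Canonical supported_group k C := group (supported_group_set k C).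

Lemma card_supported k C : #|supported k C| = (k.+1 ^ #|C|)%N.
Proof.
rewrite -[in RHS](card_ord k.+1) -(card_pffun_on (0 : 'I_k.+1)).
apply: eq_card => x; apply/supportedP/pffun_onP => [h|[/supportP h _] i iC].
  by split=> //; apply/supportP => i iC; apply: h.
exact: h.
Qed.

Lemma card_coloring k : #|coloring V k| = (k.+1 ^ #|V|)%N.
Proof. by rewrite card_ffun card_ord. Qed.

(** A subgroup that meets [mono k S] trivially has order at most the index of [mono k S]. *)
Lemma monoProb_supported k S C :
    mono k S :&: supported k C \subset [1]%g ->
  monoProb k S * k.+1%:R ^+ #|C| <= 1.
Proof.
move=> tiSC; rewrite mulrAC ler_pdivrMr ?card_coloring_gt0 // mul1r.
rewrite -natrX -natrM ler_nat -card_supported.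
by rewrite mul_cardG (trivgP tiSC) cards1 muln1 max_card.
Qed.

Hypothesis loopless : forall e, src e != tgt e.

(** The labelings supported on the vertex [tgt e] form a complement of [mono k [set e]]: exactly one
    relabeling of that vertex makes e monochromatic. *)
Lemma monoProb1 k e : monoProb k [set e] = k.+1%:R^-1.
Proof.
pose C := [set tgt e].
have k0 : k.+1%:R != 0 :> R by rewrite pnatr_eq0.
have NE : #|coloring V k|%:R != 0 :> R by rewrite gt_eqF // card_coloring_gt0.
apply: (mulIf k0); rewrite mulVf //.
have cC : #|supported k C| = k.+1 by rewrite card_supported cards1 expn1.
rewrite /monoProb -[X in _ * X%:R]cC mulrAC -natrM mul_cardG.
have -> : mono k [set e] :&: supported k C = [1]%g.
  apply/setP => x; rewrite in_setI; apply/andP/set1P.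
    move=> [/monoP hm /supportedP hs]; apply/ffunP => i; rewrite [RHS]ffunE.
    have [->|ni] := eqVneq i (tgt e); last by rewrite hs // inE.
    by rewrite -hm ?set11 // hs // inE.
  by move->; split; [apply/monoP => f _|apply/supportedP => i _]; rewrite !ffunE.
rewrite cards1 muln1.
have -> : (mono k [set e] * supported k C)%g = setT; last by rewrite cardsT divff.
apply/setP => x; rewrite [RHS]inE; apply/mulsgP.
pose y : coloring V k := [ffun i => if i == tgt e then x (src e) else x i].
exists y (- y + x).
- by apply/monoP => f /set1P->; rewrite !ffunE eqxx (negbTE (loopless e)).
- apply/supportedP => i; rewrite inE !ffunE => /negbTE->; exact: addNr.
- by rewrite [RHS]addrA subrr add0r.
Qed.

Lemma monoProb_ge k S : k.+1%:R ^- #|S| <= monoProb k S.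
Proof.
have [N] := ubnP #|S|; elim: N S => // N IHN S.
have [->|[e eS]] := set_0Vmem S; first by rewrite cards0 expr0 invr1 monoProb0.
rewrite (cardsD1 e) eS add1n !ltnS => /IHN leS.
rewrite exprS invfM -[in leRHS](setD1K eS).
rewrite (le_trans _ (monoProb_superM _ _ _)) // monoProb1 ler_wpM2l //.
by rewrite invr_ge0.
Qed.

Definition adj S : rel V := fun i j => [exists e in S,
  (src e == i) && (tgt e == j) || (src e == j) && (tgt e == i)].

Definition component S (u : V) : {set V} := [set i | connect (adj S) u i].

Lemma component_root S u : u \in component S u.
Proof. by rewrite inE connect0. Qed.

Lemma component_edge S u e :
  e \in S -> (src e \in component S u) = (tgt e \in component S u).
Proof.
move=> eS; rewrite !inE.
apply/idP/idP => /connect_trans; apply; apply: connect1;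
  by apply/existsP; exists e; rewrite eS !eqxx ?orbT.
Qed.

Lemma mono_component k S u i (x : coloring V k) :
  x \in mono k S -> i \in component S u -> x i = x u.
Proof.
move=> /monoP hx; rewrite inE => /connectP[p pth ->].
elim: p u pth => //= j p IHp u /andP[/exists_inP[e eS h] /IHp->].
by case/orP: h => /andP[/eqP<- /eqP<-]; rewrite hx.
Qed.

(** A labeling constant along S is constant on the component of u; if it is supported on the
    component minus u, it vanishes at u and hence everywhere. *)
Lemma monoProb_component k S u :
  monoProb k S * k.+1%:R ^+ #|component S u|.-1 <= 1.
Proof.
rewrite (cardsD1 u) component_root add1n /=; apply: monoProb_supported.
apply/subsetP => x; rewrite in_setI => /andP[xS /supportedP xC].
apply/set1P/ffunP => i; rewrite [RHS]ffunE.
have xu : x u = 0 by rewrite xC // !inE eqxx.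
have [iC|iC] := boolP (i \in component S u).
  by rewrite (mono_component xS iC).
by rewrite xC // in_setD1 (negbTE iC) andbF.
Qed.

Lemma monoProb_split k (C : {set V}) S T :
    (forall e, e \in S -> (src e \in C) && (tgt e \in C)) ->
    (forall e, e \in T -> (src e \notin C) && (tgt e \notin C)) ->
  monoProb k (S :|: T) = monoProb k S * monoProb k T.
Proof.
move=> hS hT; apply: monoProb_indep => x.
pose y : coloring V k := [ffun i => if i \in C then 0 else x i].
exists y; apply/monoP => e; first by case/hS/andP => s t; rewrite !ffunE s t.
by case/hT/andP => s t; rewrite !ffunE (negbTE s) (negbTE t) !subrr.
Qed.

(** Subtracting a constant d on the component of [src e] equalises the labels at the ends of e. The
    part removed is constant along S because no edge of S leaves the component. *)
Lemma monoProb_bridge k S e :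
    tgt e \notin component S (src e) ->
  monoProb k (e |: S) = monoProb k [set e] * monoProb k S.
Proof.
move=> ntgt; apply: monoProb_indep => x.
pose d : 'I_k.+1 := x (src e) - x (tgt e).
pose y : coloring V k :=
  [ffun i => if i \in component S (src e) then x i - d else x i].
exists y; apply/monoP => f.
  by move/set1P->; rewrite !ffunE component_root (negbTE ntgt) subKr.
move=> fS; rewrite !ffunE (component_edge _ fS).
by case: ifP; rewrite ?subrr // !subKr.
Qed.

Definition inner (C : {set V}) : {set E} :=
  [set e | (src e \in C) && (tgt e \in C)].

(** The shape of the nonempty edge sets whose cumulant with e can be nonzero. *)
Definition connected_through e S :=
  (tgt e \in component S (src e)) && (S \subset inner (component S (src e))).

End Graph.

(* Two colours suffice: 2^-|S| <= monoProb 1 S <= 2^(1 - |component|). *)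
Lemma card_component (V E : finType) (src tgt : E -> V) (S : {set E}) (u : V) :
  (forall e, src e != tgt e) -> (#|component src tgt S u| <= #|S|.+1)%N.
Proof.
move=> loopless; pose m := monoProb src tgt rat 1 S.
suff : (#|component src tgt S u|.-1 <= #|S|)%N by case: #|component _ _ _ _|.
rewrite leqNgt; apply/negP => lt.
suff: 1 < m * 2%:R ^+ #|component src tgt S u|.-1.
  by move=> /lt_geF; rewrite monoProb_component.
have mge : 1 <= m * 2%:R ^+ #|S|.
  by rewrite -ler_pdivrMr ?exprn_gt0 ?div1r ?monoProb_ge.
rewrite (le_lt_trans mge) // ltr_pM2l ?ltr_eXn2l ?ltr1n //.
by rewrite (lt_le_trans _ (monoProb_ge rat loopless 1 S)) ?invr_gt0 ?exprn_gt0.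
Qed.

(** * Two elementary estimates: binomial coefficients and a geometric sum *)

Lemma bin_le_exp (n m : nat) : ('C(n, m) <= n ^ m)%N.
Proof.
elim: m => [|m IHm]; first by rewrite bin0.
rewrite expnS -(@leq_pmul2l m.+1) // mul_bin_left.
by rewrite (leq_trans _ (leq_pmull _ _)) // leq_mul ?leq_subr.
Qed.

(** The right side is (1 - r)^-2 - 1, the full series of (d + 1) r^d without its term d = 0. The
    partial sum has a closed form whose remainder has a sign. *)
Lemma sum_geometric_le (R : realFieldType) (r : R) (D : nat) :
  0 < r -> r < 1 ->
  \sum_(d < D.+1 | (0 < d)%N) d.+1%:R * r ^+ d <= r * (2 - r) / (1 - r) ^+ 2.
Proof.
move=> r0 r1.
have sumE : \sum_(d < D.+1) d.+1%:R * r ^+ d * (1 - r) ^+ 2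
    = 1 - D.+2%:R * r ^+ D.+1 + D.+1%:R * r ^+ D.+2.
  elim: D => [|D IHD]; first by rewrite big_ord1 /= !exprS !expr0; ring.
  by rewrite big_ord_recr /= IHD !exprS -!natr1; ring.
rewrite ler_pdivlMr ?exprn_gt0 ?subr_gt0 // big_distrl /= big_mkcond /=.
have := sumE; rewrite !big_ord_recl /= expr0 => sumE'.
rewrite (_ : \sum_(i < D) _ = \sum_(i < D)
   (bump 0 i).+1%:R * r ^+ bump 0 i * (1 - r) ^+ 2) //.
have le : D.+1%:R * r ^+ D.+2 <= D.+2%:R * r ^+ D.+1.
  by rewrite ler_pM ?exprn_ge0 ?ler_nat ?ler_wiXn2l // ltW.
rewrite -subr_ge0; move: le sumE'; lra.
Qed.

(** * Cumulants of the community indicators *)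

Section GraphCumulant.
Variables (V E : finType) (src tgt : E -> V) (R : realFieldType).
Hypothesis loopless : forall e, src e != tgt e.
Hypothesis simple :
  forall C : {set V}, (#|inner src tgt C| <= 'C(#|C|, 2))%N.
Variables (k : nat) (e0 : E).

Local Notation m := (monoProb src tgt R k).
Local Notation connected := (connected_through src tgt e0).

(** If a does not join the ends of [e0], then [e0] is a bridge over every subset of a, so its
    indicator is independent of theirs. If a does, the edges of a outside the component of [e0] are
    independent of all the others. Either way [cumulant_eq0] applies. *)
Lemma edge_cumulant_exists : exists kap : {set E} -> R,
  [/\ is_cumulant m (fun b => m (e0 |: b)) kap,
      kap set0 = k.+1%:R^-1,
      forall a, a != set0 -> ~~ connected a -> kap a = 0
    & forall a, `|kap a| <= #|a|.+1%:R ^+ #|a| * m a].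
Proof.
have m0 := monoProb0 src tgt R k.
have [kap hk] := cumulant_exists (fun b => m (e0 |: b)) m0.
have c0 : m (e0 |: set0) = k.+1%:R^-1 by rewrite setU0 monoProb1.
exists kap; split=> //.
- have := hk set0; rewrite c0 (big_pred1 set0) ?set0D ?m0 ?mulr1 //.
  by move=> a; rewrite subset0.
- move=> a ane; rewrite negb_and.
  pose C := component src tgt a (src e0).
  have [tC /= nin|ntC _] := boolP (tgt e0 \in C).
    have out (b : {set E}) : b \subset a ->
        forall e, e \in b :\: inner src tgt C ->
        (src e \notin C) && (tgt e \notin C).
      move=> ba e; rewrite in_setD in_set => /andP[+ /(subsetP ba) ea].
      by rewrite (component_edge src tgt (src e0) ea) andbb => ->.
    apply: (@cumulant_eq0 _ _ _ _ _ a (inner src tgt C) m0 hk) => // b ba.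
      rewrite -{1}(setID b (inner src tgt C)).
      apply: (@monoProb_split _ _ _ _ R k C); last exact: out.
      by move=> e /setIP[_]; rewrite inE.
    rewrite -{1}(setID b (inner src tgt C)) setUA.
    apply: (@monoProb_split _ _ _ _ R k C); last exact: out.
    move=> e; case/setU1P => [->|/setIP[_]]; last by rewrite inE.
    by rewrite tC component_root.
  apply: (@cumulant_eq0 _ _ _ _ _ a set0 m0 hk) => [b _|b ba|].
  - by rewrite setI0 setD0 m0 mul1r.
  - rewrite setI0 setD0 setU0; apply: monoProb_bridge.
    apply: contra ntC; rewrite !inE; apply: connect_sub => i j.
    case/exists_inP => e eb h; apply: connect1; apply/exists_inP.
    by exists e => //; apply: (subsetP ba).
  - by rewrite subset0.
- apply: (cumulant_bound (c := fun b => m (e0 |: b))) => // [a|a|a b ba].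
  + exact: monoProb_ge0.
  + by rewrite monoProb_ge0 monoProb_anti // subsetUr.
  rewrite (le_trans (monoProb_superM _ _ _ _ _ _)) //.
  by rewrite -{2}(setID a b) (setIidPr ba).
Qed.

(** Such a C is determined by its v - 2 vertices besides u and w. The factor [#|V|] on the left
    replaces a division; for v < 2 there is no such C. *)
Lemma card_sets_through (u w : V) (v : nat) : u != w ->
  (#|[set C : {set V} | [&& u \in C, w \in C & #|C| == v]]| * #|V|
    <= #|V| ^ v.-1)%N.
Proof.
move=> uw; set P := [set C : {set V} | _].
have cardP C : C \in P -> #|C :\: [set u; w]| = (v - 2)%N /\ (2 <= v)%N.
  rewrite inE => /and3P[uC wC /eqP <-].
  have sub : [set u; w] \subset C by rewrite subUset !sub1set uC wC.
  have c2 : #|[set u; w]| = 2%N by rewrite cards2 uw.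
  by rewrite cardsDS // c2 -c2 subset_leq_card.
have [->|[C0 /cardP[_ v2]]] := set_0Vmem P; first by rewrite cards0.
have -> : v.-1 = (v - 2).+1 by lia.
rewrite expnSr leq_mul2r; apply/orP; right.
rewrite (leq_trans _ (bin_le_exp _ _)) // -card_draws.
have inj : {in P &, injective (fun C => C :\: [set u; w])}.
  move=> A B; rewrite !inE => /and3P[uA wA _] /and3P[uB wB _] AB.
  rewrite -(setID A [set u; w]) -(setID B [set u; w]) AB; congr (_ :|: _).
  have sub (C : {set V}) : u \in C -> w \in C -> [set u; w] \subset C.
    by move=> uC wC; rewrite subUset !sub1set uC wC.
  by rewrite !(setIidPr _) ?sub.
rewrite -(card_in_imset inj).
apply/subset_leq_card/subsetP => C' /imsetP[C CP ->].
by rewrite inE (cardP C CP).1.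
Qed.

(** Sort by the component C of a, then by v = |C|, which is at most d + 1. Inside C there are at
    most d(d + 1)/2 <= d^2 edges, so the number of choices of a is cancelled by the denominator
    (d^2)^d. At most |V|^(v-2) sets C then leave r^d / |V| for each of the d + 1 values of v. *)
Lemma sum_connected_le (d : nat) (r : R) : (0 < d)%N -> 0 <= r ->
  \sum_(a : {set E} | connected a && (#|a| == d))
     r ^+ d / (d ^ 2)%:R ^+ d / #|V|%:R ^+ #|component src tgt a (src e0)|.-1
  <= d.+1%:R * r ^+ d / #|V|%:R.
Proof.
move=> d0 r0; pose u := src e0; pose w := tgt e0.
have n0 : 0 < #|V|%:R :> R by rewrite ltr0n; apply/card_gt0P; exists u.
have d20 : 0 < (d ^ 2)%:R ^+ d :> R by rewrite exprn_gt0 // ltr0n expn_gt0 d0.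
pose P (C : {set V}) := [&& u \in C, w \in C & (#|C| <= d.+1)%N].
rewrite (partition_big (fun a => component src tgt a u) P) /=; last first.
  move=> a /andP[/andP[wC _] /eqP ad].
  by rewrite /P -ad component_root wC card_component.
apply: (@le_trans _ _ (\sum_(C | P C) r ^+ d / #|V|%:R ^+ #|C|.-1)).
  apply: ler_sum => C /and3P[uC wC Cd].
  rewrite (eq_bigr (fun=> r ^+ d / (d ^ 2)%:R ^+ d / #|V|%:R ^+ #|C|.-1));
    last by move=> a /andP[_ /eqP->].
  rewrite sumr_const -[leLHS]mulr_natr mulrAC ler_pM2r ?invr_gt0 ?exprn_gt0 //.
  rewrite -mulrA ler_piMr ?exprn_ge0 // mulrC ler_pdivrMr // mul1r.
  rewrite -natrX ler_nat.
  apply: leq_trans (_ : 'C(#|inner src tgt C|, d) <= _)%N.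
    rewrite -cards_draws -[X in (X <= _)%N]cardsE.
    apply/subset_leq_card/subsetP => a.
    by rewrite !inE => /andP[/andP[/andP[_ +] ->] /eqP <-] => ->.
  rewrite (leq_trans (bin_le_exp _ _)) // leq_exp2r //.
  rewrite (leq_trans (simple _)) // (leq_trans (leq_bin2l 2 Cd)) //.
  rewrite bin2; nia.
rewrite (partition_big (fun C : {set V} => inord #|C| : 'I_d.+2)
  (fun v : 'I_d.+2 => 0 < v)%N) /=; last first.
  move=> C /and3P[uC _ Cd]; rewrite inordK // card_gt0.
  by apply/set0Pn; exists u.
apply: (@le_trans _ _ (\sum_(v < d.+2 | (0 < v)%N) r ^+ d / #|V|%:R)).
  apply: ler_sum => v v0.
  rewrite (eq_bigr (fun=> r ^+ d / #|V|%:R ^+ v.-1)); last first.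
    by move=> C /andP[/and3P[_ _ Cd] /eqP<-]; rewrite inordK.
  rewrite sumr_const -[leLHS]mulr_natr -mulrA ler_wpM2l ?exprn_ge0 //.
  rewrite mulrC ler_pdivrMr ?exprn_gt0 // mulrC ler_pdivlMr //.
  rewrite -natrM -natrX ler_nat.
  apply: leq_trans (card_sets_through v (loopless e0)).
  rewrite leq_mul2r; apply/orP; right.
  rewrite -[X in (X <= _)%N]cardsE; apply/subset_leq_card/subsetP => C.
  rewrite !inE => /andP[/and3P[-> -> Cd] /eqP<-] /=.
  by rewrite inordK.
rewrite big_mkcond big_ord_recl /= add0r sumr_const card_ord.
by rewrite -mulrA mulr_natl.
Qed.

Lemma cumulant_energy_le (D : nat) (r l : R) (kap : {set E} -> R) :
    (1 <= D)%N -> 0 < r -> r < 1 -> 0 <= l ->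
    l <= r / (D%:R * (D%:R + 1)) ^+ 2
         * Num.min (k.+1%:R ^+ 2 / #|V|%:R) 1 ->
    (forall a, a != set0 -> ~~ connected a -> kap a = 0) ->
    (forall a, `|kap a| <= #|a|.+1%:R ^+ #|a| * m a) ->
  \sum_(a : {set E} | (a != set0) && (#|a| <= D)%N) kap a ^+ 2 * l ^+ #|a|
    <= r * (2 - r) / ((1 - r) ^+ 2 * #|V|%:R).
Proof.
move=> D0 r0 r1 l0 hl hconn hbnd.
have n0 : 0 < #|V|%:R :> R by rewrite ltr0n; apply/card_gt0P; exists (src e0).
apply: (@le_trans _ _ (\sum_(d < D.+1 | (0 < d)%N) d.+1%:R * r ^+ d / #|V|%:R));
  last first.
  rewrite -big_distrl /= invfM mulrA ler_pM2r ?invr_gt0 //.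
  exact: sum_geometric_le.
rewrite (partition_big (fun a : {set E} => inord #|a| : 'I_D.+1)
  (fun d : 'I_D.+1 => 0 < d)%N) /=; last first.
  by move=> a /andP[ane aD]; rewrite inordK // card_gt0.
apply: ler_sum => d d0.
apply: le_trans (sum_connected_le d0 (ltW r0)).
rewrite (bigID (fun a => connected a)) /= [X in _ + X]big1 ?addr0; last first.
  by move=> a /andP[/andP[/andP[ane _] _] nc]; rewrite hconn // expr0n mul0r.
rewrite big_mkcond [leRHS]big_mkcond /=; apply: ler_sum => a _.
case: ifP => [/andP[/andP[/andP[ane aD] /eqP ad] conn]|_]; last first.
  by case: ifP => // _; rewrite !divr_ge0 ?exprn_ge0 // ltW.
have {}ad : #|a| = d by rewrite -ad inordK.
rewrite conn ad eqxx /=.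
have := hbnd a; rewrite ad => {}hbnd.
have := monoProb_component src tgt R k a (src e0).
have := card_component a (src e0) loopless.
have /card_gt0P : exists i, i \in component src tgt a (src e0).
  by exists (src e0); rewrite component_root.
(* Here v is the size of the component minus one, hence at most d. *)
case: #|_| => // v _; rewrite ltnS ad /= => vd hm.
set mu := Num.min _ _ in hl; set Q := r / _ in hl.
have K0 : 0 < k.+1%:R :> R by rewrite ltr0n.
have mu0 : 0 <= mu by rewrite le_min divr_ge0 ?exprn_ge0 ?ler01.
have ma0 := monoProb_ge0 src tgt R k a.
have Q0 : 0 <= Q by rewrite divr_ge0 ?sqr_ge0 // ltW.
have lQ : l ^+ d <= Q ^+ d * mu ^+ d.
  by rewrite -exprMn lerXn2r ?nnegrE // mulr_ge0.
(* The cap mu <= 1 lets the exponent drop from d to v. The power of [k.+1] is then absorbed by the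
   squared [m a] through [mK], and only |V|^-v remains. *)
have mud : mu ^+ d <= (k.+1%:R ^+ 2 / #|V|%:R) ^+ v.
  apply: (@le_trans _ _ (mu ^+ v)).
    by rewrite ler_wiXn2l ?mu0 // ge_min lexx orbT.
  by rewrite lerXn2r ?nnegrE ?divr_ge0 ?exprn_ge0 ?ge_min ?lexx // ltW.
have mK : m a ^+ 2 * (k.+1%:R ^+ 2) ^+ v <= 1.
  by rewrite exprAC -exprMn expr_le1 // mulr_ge0 ?exprn_ge0.
(* The square of D(D + 1) pays both for (d + 1)^2 from the cumulant bound and for d^2 from the count
   of edge sets, since d <= D. *)
have dQ : (d.+1%:R ^+ d) ^+ 2 * Q ^+ d <= r ^+ d / (d ^ 2)%:R ^+ d.
  have d0' : 0 < d%:R :> R by rewrite ltr0n.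
  have dD : d%:R <= D%:R :> R by rewrite ler_nat -ltnS.
  rewrite exprAC -exprMn -expr_div_n natrX.
  rewrite lerXn2r ?nnegrE ?(mulr_ge0 _ Q0) ?(divr_ge0 (ltW r0)) ?sqr_ge0 //.
  have DD : 0 < D%:R * (D%:R + 1) :> R.
    by rewrite mulr_gt0 ?ltr_wpDr // (lt_le_trans d0').
  rewrite /Q mulrCA ler_pM2l // ler_pdivrMr ?exprn_gt0 //.
  rewrite mulrC ler_pdivlMr ?exprn_gt0 // -exprMn -natr1.
  rewrite lerXn2r ?nnegrE ?(ltW DD) ?mulr_ge0 ?addr_ge0 //.
  by rewrite mulrC ler_pM ?addr_ge0 ?lerD2r.
have kap2 : kap a ^+ 2 <= (d.+1%:R ^+ d) ^+ 2 * m a ^+ 2.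
  rewrite -exprMn -(real_normK (num_real (kap a))) lerXn2r ?nnegrE //.
  by rewrite mulr_ge0 ?exprn_ge0.
apply: le_trans (ler_pM _ _ kap2 lQ) _; rewrite ?sqr_ge0 ?exprn_ge0 //.
rewrite mulrACA ler_pM ?(mulr_ge0 (sqr_ge0 _)) ?exprn_ge0 //.
apply: le_trans (ler_wpM2l (sqr_ge0 _) mud) _; rewrite (expr_div_n _ _ v) mulrA.
by rewrite ler_pdivrMr ?exprn_gt0 // mulVf // expf_neq0 // gt_eqF.
Qed.

End GraphCumulant.

(** * Low-degree functions and duality *)

Section Monomial.
Variables (R : realFieldType) (E : finType) (D : nat).
Implicit Types (g : {ffun E -> bool} -> R).

(** Powers of 0/1 entries collapse, so square-free monomials, one per edge set, suffice; the list
    may repeat a set. *)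
Definition low_degree g := exists c : seq (R * {set E}),
  (forall t, t \in c -> (#|t.2| <= D)%N) /\
  forall A, g A = \sum_(t <- c) t.1 * \prod_(e in t.2) (A e)%:R.

Definition monomial d g := exists (c : R) (T : {set E}),
  (#|T| <= d)%N /\ forall A, g A = c * \prod_(e in T) (A e)%:R.

Lemma prod_boolU (A : {ffun E -> bool}) (S T : {set E}) :
  \prod_(e in S :|: T) (A e)%:R
    = (\prod_(e in S) (A e)%:R) * \prod_(e in T) (A e)%:R :> R.
Proof.
rewrite !(big_mkcond (fun e => e \in _)) -big_split; apply: eq_bigr => e _ /=.
rewrite in_setU; case: (e \in S); case: (e \in T); case: (A e) => /=; ring.
Qed.

Lemma monomial1 : monomial 0 (fun=> 1).
Proof.
by exists 1, set0; rewrite cards0; split=> // A; rewrite big_set0 mulr1.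
Qed.

Lemma monomialM d d' g g' :
  monomial d g -> monomial d' g' -> monomial (d + d') (fun A => g A * g' A).
Proof.
move=> [c [T [Td gE]]] [c' [T' [Td' gE']]]; exists (c * c'), (T :|: T').
split=> [|A]; last by rewrite gE gE' prod_boolU; ring.
by rewrite (leq_trans (leq_card_setU _ _)) // leq_add.
Qed.

Lemma monomialX d g j : monomial d g -> monomial (d * j) (fun A => g A ^+ j).
Proof.
move=> gd; elim: j => [|j IHj]; first by rewrite muln0; apply: monomial1.
have [c [T [Tj gE]]] := monomialM gd IHj; exists c, T.
by rewrite mulnS; split=> // A; rewrite exprS gE.
Qed.

Lemma monomial_prod (I : Type) (s : seq I) (d : I -> nat)
    (g : I -> {ffun E -> bool} -> R) :
  (forall i, monomial (d i) (g i)) ->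
  monomial (\sum_(i <- s) d i) (fun A => \prod_(i <- s) g i A).
Proof.
move=> gd; elim: s => [|i s IHs].
  have [c [T [T0 gE]]] := monomial1; exists c, T; rewrite big_nil.
  by split=> // A; rewrite big_nil -gE.
have [c [T [Ts gE]]] := monomialM (gd i) IHs; exists c, T; rewrite big_cons.
by split=> // A; rewrite big_cons gE.
Qed.

Lemma low_degree_sum (I : eqType) (s : seq I) (a : I -> R) (d : I -> nat)
    (g : I -> {ffun E -> bool} -> R) :
  (forall i, i \in s -> (d i <= D)%N /\ monomial (d i) (g i)) ->
  low_degree (fun A => \sum_(i <- s) a i * g i A).
Proof.
elim: s => [|i s IHs] gd; first by exists [::]; split=> // A; rewrite !big_nil.
have [|l [lD lE]] := IHs; first by move=> j js; apply: gd; rewrite inE js orbT.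
have [diD [c [T [Td gE]]]] := gd i (mem_head _ _).
exists ((a i * c, T) :: l); split=> [t|A].
  by rewrite inE => /orP[/eqP->|/lD] //; apply: leq_trans diD.
by rewrite !big_cons gE lE mulrA.
Qed.

End Monomial.

(** Pointwise (f - x)^2 - x^2 + g^2 - 2 f (g - x) = (f - g)^2 >= 0, and the cross term has weighted
    sum zero. *)
Lemma dual_lower_bound (R : realFieldType) (O : finType) (W f x g : O -> R) :
    (forall o, 0 <= W o) -> \sum_o W o * (f o * (g o - x o)) = 0 ->
  \sum_o W o * x o ^+ 2 - \sum_o W o * g o ^+ 2
    <= \sum_o W o * (f o - x o) ^+ 2.
Proof.
move=> W0 orth.
have -> : \sum_o W o * x o ^+ 2 - \sum_o W o * g o ^+ 2
    = \sum_o (W o * x o ^+ 2 - W o * g o ^+ 2 + 2 * (W o * (f o * (g o - x o)))).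
  by rewrite big_split sumrB -big_distrr /= orth mulr0 addr0.
apply: ler_sum => o _.
have := mulr_ge0 (W0 o) (sqr_ge0 (f o - g o)); rewrite !expr2; lra.
Qed.

(** * The noise coupling and its score functions *)

Section Coupling.
Variables (R : realFieldType) (p q : R).

(* Each edge is forced present, forced absent, or ([None]) copies the community
   indicator of its endpoints; the mixture is Bernoulli(p) inside a community
   and Bernoulli(q) across. *)
Definition noise_pmf (x : option bool) : R :=
  match x with Some true => q | Some false => 1 - p | None => p - q end.

(* Under [noise_pmf] this has mean zero and covariance 1 with the observed edge,
   whatever the community indicator is. *)
Definition noise_score (x : option bool) : R :=
  match x with Some true => q^-1 | Some false => - (1 - p)^-1 | None => 0 end.

(** The second moment of [noise_score]. *)
Definition noise_info : R := q^-1 + (1 - p)^-1.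

Hypotheses (q0 : 0 < q) (qp : q < p) (p1 : p < 1).

Lemma sum_option_bool (F : option bool -> R) :
  \sum_x F x = F (Some true) + F (Some false) + F None.
Proof.
rewrite (bigD1 None) //= (bigD1 (Some true)) //= (bigD1 (Some false)) //=.
rewrite big1 ?addr0 => [|[[]|]] //; last by rewrite addrC.
Qed.

Lemma noise_pmf_ge0 x : 0 <= noise_pmf x.
Proof. by case: x => [[]|] /=; rewrite ?subr_ge0 ltW. Qed.

Variable E : finType.
Local Notation noise := {ffun E -> option bool}.

Definition noise_prob (s : noise) : R := \prod_e noise_pmf (s e).

Definition score (a : {set E}) (s : noise) : R :=
  \prod_(e in a) noise_score (s e).

Definition observed (b : E -> bool) (s : noise) : {ffun E -> bool} :=
  [ffun e => odflt (b e) (s e)].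

(** For fixed indicators, an edge is present with probability q + (p - q) b_e. The noise
    configurations that produce a given A form a product set, so their total mass factors over
    edges. *)
Lemma observed_law (b : E -> bool) (F : {ffun E -> bool} -> R) :
  \sum_(A : {ffun E -> bool})
    (\prod_e let t := if b e then p else q in if A e then t else 1 - t) * F A
  = \sum_s noise_prob s * F (observed b s).
Proof.
rewrite [RHS](partition_big (observed b) xpredT) //=.
apply: eq_bigr => A _.
rewrite (eq_bigr (fun s => noise_prob s * F A)); last by move=> s /eqP->.
rewrite -big_distrl /=; congr (_ * _).
rewrite (eq_bigl (fun s : noise =>
  s \in family (fun e => [pred x | odflt (b e) x == A e]))); last first.
  move=> s; apply/eqP/familyP => [<- e|h]; first by rewrite inE ffunE.
  by apply/ffunP => e; rewrite ffunE; apply/eqP; have := h e; rewrite inE.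
rewrite -(bigA_distr_big_dep _ (fun e x => noise_pmf x)).
apply: eq_bigr => e _; rewrite big_mkcond sum_option_bool /=.
by case: (b e); case: (A e) => /=; ring.
Qed.

Lemma sum_noise_prod (g : E -> option bool -> R) :
  \sum_s noise_prob s * \prod_e g e (s e)
    = \prod_e \sum_x noise_pmf x * g e x.
Proof.
rewrite (bigA_distr_bigA (fun e x => noise_pmf x * g e x)).
by apply: eq_bigr => s _; rewrite -big_split.
Qed.

(** The noise is independent across edges: an edge in only one of the sets contributes the mean 0 of
    the score, an edge in both contributes [noise_info]. *)
Lemma score_orthogonal (a a' : {set E}) :
  \sum_s noise_prob s * (score a s * score a' s)
    = if a == a' then noise_info ^+ #|a| else 0.
Proof.
rewrite (eq_bigr (fun s => noise_prob s * \prod_e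
   ((if e \in a then noise_score (s e) else 1)
    * (if e \in a' then noise_score (s e) else 1)))); last first.
  move=> s _; rewrite big_split /= /score big_mkcond.
  by rewrite (big_mkcond (fun e => e \in a')).
rewrite (sum_noise_prod (fun e x => (if e \in a then noise_score x else 1)
    * (if e \in a' then noise_score x else 1))).
have fE e : \sum_x noise_pmf x * ((if e \in a then noise_score x else 1)
    * (if e \in a' then noise_score x else 1)) =
  if (e \in a) == (e \in a') then (if e \in a then noise_info else 1) else 0.
  rewrite sum_option_bool /noise_info /=.
  have qn : q != 0 by rewrite gt_eqF.
  have pn : 1 - p != 0 by rewrite gt_eqF // subr_gt0.
  by case: (e \in a); case: (e \in a') => /=; field; rewrite ?qn ?pn.
under eq_bigr => e _ do rewrite fE.
case: eqP => [<-|neq].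
  by under eq_bigr do rewrite eqxx; rewrite -big_mkcond prodr_const.
have [e ne] : exists e, (e \in a) != (e \in a').
  apply/existsP; apply: contra_notT neq => /existsPn h; apply/setP => e.
  by have := h e; rewrite negbK => /eqP.
by rewrite (bigD1 e) //= (negbTE ne) mul0r.
Qed.

(** An edge in both sets contributes the covariance 1, an edge of a alone the mean 0 of the score,
    and an edge of T alone the mean (p - q) b_e of A_e - q. Centering at q makes this last mean
    proportional to the indicator. *)
Lemma score_moment (a T : {set E}) (b : E -> bool) :
  \sum_s noise_prob s
     * ((\prod_(e in T) ((observed b s e)%:R - q)) * score a s)
    = if a \subset T then (p - q) ^+ #|T :\: a| * \prod_(e in T :\: a) (b e)%:R
      else 0.
Proof.
pose g e x : R := (if e \in T then (odflt (b e) x)%:R - q else 1)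
    * (if e \in a then noise_score x else 1).
rewrite (eq_bigr (fun s => noise_prob s * \prod_e g e (s e))); last first.
  move=> s _; rewrite big_split /= /score big_mkcond.
  rewrite (big_mkcond (fun e => e \in a)).
  by congr (_ * (_ * _)); apply: eq_bigr => e _; rewrite ffunE.
rewrite sum_noise_prod.
have gE e : \sum_x noise_pmf x * g e x =
  if e \in a then (e \in T)%:R else if e \in T then (p - q) * (b e)%:R else 1.
  rewrite sum_option_bool /g /=.
  have qn : q != 0 by rewrite gt_eqF.
  have pn : 1 - p != 0 by rewrite gt_eqF // subr_gt0.
  by case: (e \in a); case: (e \in T); case: (b e) => /=; field; rewrite ?qn ?pn.
under eq_bigr => e _ do rewrite gE.
case: ifP => [/subsetP aT|/negbT/subsetPn[e ea neT]]; last first.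
  by rewrite (bigD1 e) //= ea (negbTE neT) mul0r.
rewrite -prodr_const -big_split /= [RHS]big_mkcond; apply: eq_bigr => e _.
rewrite in_setD; case: ifP => // /aT -> //.
Qed.

End Coupling.

(** * The dual function and the risk of a single entry *)

Section LowDegree.
Variables (V E : finType) (src tgt : E -> V) (R : realFieldType).
Variables (k : nat) (e0 : E) (p q : R).
Hypotheses (loopless : forall e, src e != tgt e)
  (simple : forall C : {set V}, (#|inner src tgt C| <= 'C(#|C|, 2))%N)
  (q0 : 0 < q) (qp : q < p) (p1 : p < 1).

Local Notation m := (monoProb src tgt R k).
Local Notation noise := {ffun E -> option bool}.
Local Notation Omega := (coloring V k * noise)%type.

Definition same (x : coloring V k) (e : E) : bool := x (src e) == x (tgt e).

Definition weight (o : Omega) : R :=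
  #|coloring V k|%:R^-1 * noise_prob p q o.2.

Lemma sum_weight (F : coloring V k -> noise -> R) :
  \sum_(o : Omega) weight o * F o.1 o.2 =
  #|coloring V k|%:R^-1 * \sum_x \sum_s noise_prob p q s * F x s.
Proof.
rewrite pair_big big_distrr /=.
by apply: eq_bigr => -[x s] _; rewrite /weight /= mulrA.
Qed.

Lemma mean_same (T : {set E}) :
  #|coloring V k|%:R^-1 * \sum_x \prod_(e in T) (same x e)%:R = m T.
Proof.
rewrite /monoProb mulrC; congr (_ / _).
rewrite -sum1_card natr_sum [RHS]big_mkcond /=; apply: eq_bigr => x _.
case: ifP => [/monoP h|/negbT h].
  by rewrite big1 // => e /h; rewrite /same => ->; rewrite eqxx.
have [e eT ne] : exists2 e, e \in T & ~~ same x e.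
  by apply/exists_inP; rewrite inE negb_forall_in in h.
by rewrite (bigD1 e) //= (negbTE ne) mul0r.
Qed.

Section Dual.
Variables (D : nat) (kap : {set E} -> R).
Hypothesis kapP : is_cumulant m (fun b => m (e0 |: b)) kap.

(** The power of p - q is chosen so that, together with the power of [#|T :\: a|] in [score_moment],
    every term of the pairing with an edge set b carries (p - q)^(|b| + 1), as the target does. *)
Definition dual (s : noise) : R :=
  \sum_(a : {set E} | (#|a| <= D)%N)
    (p - q) ^+ #|a|.+1 * kap a * score p q a s.

Local Notation obs o := (observed (same o.1) o.2).
Local Notation target o := ((p - q) * (same o.1 e0)%:R).

Lemma dual_energy :
  \sum_(o : Omega) weight o * dual o.2 ^+ 2
    = (p - q) ^+ 2 * \sum_(a : {set E} | (#|a| <= D)%N)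
        kap a ^+ 2 * ((p - q) ^+ 2 * noise_info p q) ^+ #|a|.
Proof.
rewrite (sum_weight (fun _ s => dual s ^+ 2)).
rewrite sumr_const -[X in _ * X]mulr_natl mulrA mulVf ?mul1r; last first.
  by rewrite gt_eqF // card_coloring_gt0.
transitivity (\sum_(a : {set E} | (#|a| <= D)%N)
   \sum_(a' : {set E} | (#|a'| <= D)%N)
   (p - q) ^+ #|a|.+1 * kap a * ((p - q) ^+ #|a'|.+1 * kap a')
     * \sum_s noise_prob p q s * (score p q a s * score p q a' s)).
  under eq_bigr => s _.
    rewrite expr2 /dual big_distrlr big_distrr /=.
    under eq_bigr do rewrite big_distrr /=.
    over.
  rewrite exchange_big /=; apply: eq_bigr => a _.
  rewrite exchange_big /=; apply: eq_bigr => a' _.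
  by rewrite big_distrr; apply: eq_bigr => s _ /=; ring.
rewrite big_distrr; apply: eq_bigr => a aD /=.
rewrite (bigD1 a) //= [X in _ + X]big1 ?addr0 => [|a' /andP[_ na]]; last first.
  by rewrite score_orthogonal // eq_sym (negbTE na) mulr0.
by rewrite score_orthogonal // eqxx exprMn -exprM mulnC exprM !exprS; ring.
Qed.

(** Only the sets a inside b survive the noise average, and the truncation at D keeps all of them.
    The label average of what remains is the cumulant relation [kapP] at b. *)
Lemma dual_cross (b : {set E}) : (#|b| <= D)%N ->
  \sum_(o : Omega) weight o
     * ((\prod_(e in b) ((obs o e)%:R - q)) * (dual o.2 - target o)) = 0.
Proof.
move=> bD.
pose Y (x : coloring V k) (s : noise) : R :=
  \prod_(e in b) ((observed (same x) s e)%:R - q).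
rewrite (sum_weight (fun x s => Y x s * (dual s - (p - q) * (same x e0)%:R))).
have dualE x : \sum_s noise_prob p q s * (Y x s * dual s)
    = (p - q) ^+ #|b|.+1 * \sum_(a : {set E} | a \subset b)
        kap a * \prod_(e in b :\: a) (same x e)%:R.
  under eq_bigr do rewrite /dual !big_distrr /=.
  rewrite exchange_big /= big_distrr /= [LHS]big_mkcond [RHS]big_mkcond /=.
  apply: eq_bigr => a _.
  have [ab|nab] := boolP (a \subset b).
    have bE : #|b| = (#|b :\: a| + #|a|)%N.
      by rewrite cardsDS // subnK // subset_leq_card.
    rewrite (leq_trans (subset_leq_card ab) bD).
    transitivity ((p - q) ^+ #|a|.+1 * kap a * \sum_s noise_prob p q s
        * (Y x s * score p q a s)).
      by rewrite big_distrr; apply: eq_bigr => s _ /=; ring.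
    by rewrite score_moment // ab bE !exprS exprD; ring.
  case: ifP => // _.
  transitivity ((p - q) ^+ #|a|.+1 * kap a * \sum_s noise_prob p q s
        * (Y x s * score p q a s)).
    by rewrite big_distrr; apply: eq_bigr => s _ /=; ring.
  by rewrite score_moment // (negbTE nab) mulr0.
have targetE x : \sum_s noise_prob p q s * (Y x s * ((p - q) * (same x e0)%:R))
    = (p - q) ^+ #|b|.+1 * \prod_(e in e0 |: b) (same x e)%:R.
  transitivity ((p - q) * (same x e0)%:R * \sum_s noise_prob p q s
      * (Y x s * score p q set0 s)).
    rewrite big_distrr; apply: eq_bigr => s _ /=.
    by rewrite /score big_set0; ring.
  rewrite score_moment // sub0set setD0 exprS.
  have -> : \prod_(e in e0 |: b) (same x e)%:R
      = (same x e0)%:R * \prod_(e in b) (same x e)%:R :> R.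
    have [e0b|ne0b] := boolP (e0 \in b); last by rewrite big_setU1.
    rewrite (setUidPr _) ?sub1set // (bigD1 e0) //= mulrA -natrM mulnb andbb.
    by [].
  by ring.
under eq_bigr => x _.
  under eq_bigr do rewrite mulrBr mulrBr.
  rewrite sumrB dualE targetE -mulrBr.
  over.
rewrite -big_distrr /= sumrB mulrCA mulrBr mean_same kapP exchange_big /=.
rewrite big_distrr /= [X in _ * (X - _)](_ : _ = \sum_(a : {set E} | a \subset b)
  kap a * m (b :\: a)) ?subrr ?mulr0 //.
apply: eq_bigr => a _.
by rewrite -big_distrr mulrCA mean_same.
Qed.

(** Write A_e = (A_e - q) + q and expand over subsets of T, none of which exceeds D edges. *)
Lemma dual_cross_monomial (T : {set E}) : (#|T| <= D)%N ->
  \sum_(o : Omega) weight o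
     * ((\prod_(e in T) (obs o e)%:R) * (dual o.2 - target o)) = 0.
Proof.
move=> TD.
have monE (A : {ffun E -> bool}) : \prod_(e in T) (A e)%:R
    = \sum_(b : {set E} | b \subset T)
        (\prod_(e in b) ((A e)%:R - q)) * q ^+ #|T :\: b|.
  rewrite -(eq_bigr _ (fun e _ => subrK q (A e)%:R)) prodrD_subset.
  by apply: eq_bigr => b _; rewrite prodr_const.
under eq_bigr do rewrite monE big_distrl big_distrr /=.
rewrite exchange_big big1 //= => b bT.
have bD := leq_trans (subset_leq_card bT) TD.
rewrite -[RHS](mulr0 (q ^+ #|T :\: b|)) -[X in _ = _ * X](dual_cross bD).
by rewrite big_distrr; apply: eq_bigr => o _ /=; ring.
Qed.

End Dual.

Lemma low_degree_risk (D : nat) (r : R) (f : {ffun E -> bool} -> R) :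
    (1 <= D)%N -> 0 < r -> r < 1 ->
    (p - q) ^+ 2 / (q * (1 - p))
      <= r / (D%:R * (D%:R + 1)) ^+ 2 * Num.min (k.+1%:R ^+ 2 / #|V|%:R) 1 ->
    low_degree D f ->
  (p - q) ^+ 2 / k.+1%:R
     - (p - q) ^+ 2
       * (1 / k.+1%:R ^+ 2 + r * (2 - r) / ((1 - r) ^+ 2 * #|V|%:R))
  <= #|coloring V k|%:R^-1 * \sum_x \sum_s noise_prob p q s
       * (f (observed (same x) s) - (if same x e0 then p else q)) ^+ 2.
Proof.
move=> D1 r0 r1 hsnr [c [cD fE]].
have [kap [kapP kap0 kapC kapB]] := edge_cumulant_exists R loopless k e0.
rewrite -(sum_weight (fun x s =>
  (f (observed (same x) s) - (if same x e0 then p else q)) ^+ 2)).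
pose target (o : Omega) := (p - q) * (same o.1 e0)%:R.
have W0 o : 0 <= weight o.
  by rewrite mulr_ge0 ?invr_ge0 // prodr_ge0 // => e _; apply: noise_pmf_ge0.
(* The target is the entry of M minus q, so f is shifted by q as well; the constant is paired as the
   monomial of the empty set. *)
have orth : \sum_o weight o * ((f (observed (same o.1) o.2) - q)
    * (dual D kap o.2 - target o)) = 0.
  under eq_bigr do rewrite mulrBl mulrBr.
  rewrite sumrB [X in _ - X](_ : _ = 0) ?subr0; last first.
    have /(dual_cross_monomial kapP) h0 : (#|@set0 E| <= D)%N.
      by rewrite cards0.
    rewrite -[RHS](mulr0 q) -[X in _ = _ * X]h0.
    rewrite big_distrr; apply: eq_bigr => o _ /=.
    by rewrite big_set0 /target; ring.
  under eq_bigr do rewrite fE big_distrl big_distrr /=.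
  rewrite exchange_big big_seq big1 //= => t /cD tD.
  rewrite -[RHS](mulr0 t.1) -[X in _ = _ * X](dual_cross_monomial kapP tD).
  by rewrite big_distrr; apply: eq_bigr => o _ /=; rewrite /target; ring.
have := dual_lower_bound W0 orth; rewrite dual_energy => lower.
apply: le_trans (le_trans lower _); last first.
  rewrite le_eqVlt; apply/orP; left; apply/eqP.
  apply: eq_bigr => o _; congr (_ * _ ^+ 2).
  by rewrite /target; case: (same o.1 e0) => /=; ring.
have -> : \sum_o weight o * target o ^+ 2 = (p - q) ^+ 2 / k.+1%:R.
  rewrite (sum_weight (fun x _ => ((p - q) * (same x e0)%:R) ^+ 2)).
  rewrite -(monoProb1 R loopless k e0) -mean_same mulrCA; congr (_ * _).
  rewrite big_distrr; apply: eq_bigr => x _ /=; rewrite big_set1.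
  (* With both sets empty, [score_moment] says that the noise has total mass 1. *)
  have := score_moment q0 p1 set0 set0 (same x).
  rewrite sub0set setD0 cards0 big_set0 mulr1 => sum1.
  rewrite -[RHS]mulr1 -[X in _ = _ * X]sum1 big_distrr; apply: eq_bigr => s _.
  by rewrite /score !big_set0 exprMn /=; case: same => /=; ring.
rewrite lerD2l lerN2 ler_pM2l ?exprn_gt0 ?subr_gt0 //.
(* The empty edge set has cumulant [k.+1%:R^-1], whose square is the first error term; the nonempty
   sets give the second. *)
rewrite (bigD1 set0) ?cards0 //= expr0 mulr1 kap0 exprVn div1r lerD2l.
have info : noise_info p q = (1 - p + q) / (q * (1 - p)).
  by rewrite /noise_info; field; rewrite ?gt_eqF ?subr_gt0.
have info0 : 0 <= noise_info p q.
  by rewrite addr_ge0 ?invr_ge0 ?subr_ge0 ?ltW.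
rewrite (eq_bigl (fun a : {set E} => (a != set0) && (#|a| <= D)%N)); last first.
  by move=> a; rewrite andbC.
apply: (cumulant_energy_le loopless simple D1 r0 r1) kapC kapB => //.
  by rewrite mulr_ge0 // sqr_ge0.
(* The numerator 1 - (p - q) of [noise_info] is below 1, so (p - q)^2 times [noise_info] is at most
   the ratio bounded in [hsnr]. *)
apply: le_trans hsnr; rewrite ler_pM2l ?exprn_gt0 ?subr_gt0 //.
have qp0 : 0 < q * (1 - p) by rewrite mulr_gt0 ?subr_gt0.
by rewrite info ler_pdivrMr // mulVf ?gt_eqF // -lerBrDr lerD2l lerN2 ltW.
Qed.

End LowDegree.

(** * Adjacency matrices *)

Section Edges.
Variable n : nat.

Definition edge := {x : 'I_n * 'I_n | (x.1 < x.2)%N}.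
Definition edge_src (e : edge) : 'I_n := (val e).1.
Definition edge_tgt (e : edge) : 'I_n := (val e).2.

Lemma edge_loopless e : edge_src e != edge_tgt e.
Proof. by rewrite neq_ltn (valP e). Qed.

Definition edge_ends (e : edge) : {set 'I_n} := [set edge_src e; edge_tgt e].

Lemma edge_ends_inj : injective edge_ends.
Proof.
move=> [[i j] /= ij] [[i' j'] /= ij'] /setP h; apply: val_inj => /=.
move: (h i) (h j) (h i') (h j'); rewrite !inE /edge_src /edge_tgt /= !eqxx !orbT.
rewrite -!val_eqE /= => h1 h2 h3 h4.
have [ii jj] : i = i' :> nat /\ j = j' :> nat by lia.
by congr (_, _); apply: val_inj.
Qed.

Lemma card_inner_edges (C : {set 'I_n}) :
  (#|inner edge_src edge_tgt C| <= 'C(#|C|, 2))%N.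
Proof.
rewrite -cards_draws -(card_imset _ edge_ends_inj).
apply/subset_leq_card/subsetP => _ /imsetP[e + ->].
rewrite !inE => /andP[sC tC]; rewrite cards2 edge_loopless /=.
by rewrite subUset !sub1set sC tC.
Qed.

Lemma card_edge : #|{: edge}| = 'C(n, 2).
Proof.
rewrite -[in RHS](card_ord n) -card_draws -(card_codom edge_ends_inj).
apply: eq_card => B; rewrite inE; apply/codomP/idP => [[e ->]|].
  by rewrite cards2 edge_loopless.
case/cards2P => i [j [ij ->]].
case: (ltngtP i j) => [lt|lt|/val_inj eq]; last by rewrite eq eqxx in ij.
  by exists (Sub (i, j) lt).
by exists (Sub (j, i) lt); rewrite setUC.
Qed.

Lemma big_edge (T : Type) (idx : T) (op : Monoid.com_law idx)
    (F : 'I_n -> 'I_n -> T) :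
  \big[op/idx]_(i < n) \big[op/idx]_(j < n | (i < j)%N) F i j
    = \big[op/idx]_(e : edge) F (edge_src e) (edge_tgt e).
Proof.
rewrite (pair_big_dep xpredT (fun i j : 'I_n => (i < j)%N)) /=.
exact: (big_sub [pred x : 'I_n * 'I_n | (x.1 < x.2)%N] (fun x => F x.1 x.2)).
Qed.

Definition graph_mx (A : {ffun edge -> bool}) : 'M[bool]_n :=
  \matrix_(i, j) if insub (i, j) is Some e then A e else
                 if insub (j, i) is Some e then A e else false.

Lemma graph_mxE (A : {ffun edge -> bool}) (e : edge) :
  graph_mx A (edge_src e) (edge_tgt e) = A e.
Proof. by rewrite mxE -surjective_pairing valK. Qed.

Lemma graph_mx_adjacency (A : {ffun edge -> bool}) :
  ((graph_mx A)^T == graph_mx A) && [forall i, ~~ graph_mx A i i].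
Proof.
apply/andP; split; last first.
  by apply/forallP => i; rewrite mxE insubF //= ltnn.
apply/eqP/matrixP => i j; rewrite !mxE.
case: insubP => [e /= lt _|/= nlt]; case: insubP => [e' /= lt' _|/= nlt'] //.
by have := ltn_trans lt lt'; rewrite ltnn.
Qed.

(** Only symmetric matrices with zero diagonal carry mass, and [graph_mx] puts them in bijection
    with edge configurations. *)
Lemma adjacency_sum (R : realType) (M : 'M[R]_n) (F : 'M[bool]_n -> R) :
  \sum_A adjacency_pmf M A * F A
    = \sum_(A : {ffun edge -> bool})
        (\prod_e bernoulli_pmf (M (edge_src e) (edge_tgt e)) (A e))
        * F (graph_mx A).
Proof.
pose valid (A : 'M[bool]_n) := (A^T == A) && [forall i, ~~ A i i].
rewrite (bigID valid) /= [X in _ + X]big1 ?addr0; last first.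
  by move=> A /negbTE nv; rewrite /adjacency_pmf -/(valid A) nv mul0r.
pose entries (A : 'M[bool]_n) : {ffun edge -> bool} :=
  [ffun e => A (edge_src e) (edge_tgt e)].
rewrite (reindex_onto graph_mx entries) /=; last first.
  move=> A /andP[/eqP symA /forallP diagA]; apply/matrixP => i j; rewrite mxE.
  case: insubP => [e _ eE|/= ij]; first by rewrite ffunE /edge_src /edge_tgt eE.
  case: insubP => [e _ eE|/= ji].
    by rewrite ffunE /edge_src /edge_tgt eE -[in RHS]symA mxE.
  have -> : i = j by apply: val_inj; move: ij ji => /=; lia.
  by rewrite (negbTE (diagA j)).
apply: eq_big => [A|A _].
  rewrite /valid graph_mx_adjacency; apply/eqP/ffunP => e.
  by rewrite ffunE graph_mxE.
rewrite /adjacency_pmf graph_mx_adjacency; congr (_ * _).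
rewrite (big_edge _ (fun i j => bernoulli_pmf (M i j) (graph_mx A i j))).
by apply: eq_bigr => e _; rewrite graph_mxE.
Qed.

(** On an adjacency matrix each variable is a single edge bit or, on the diagonal, 0. So a monomial
    of degree d involves at most d edges. *)
Lemma poly_estimate_low_degree (R : realType) (D : nat)
    (P : 'M[{mpoly R[n * n]}]_n) (i j : 'I_n) :
  (msize (P i j) <= D.+1)%N ->
  low_degree D (fun A => poly_estimate P (graph_mx A) i j).
Proof.
move=> PD.
pose v (A : {ffun edge -> bool}) : 'I_(n * n) -> R :=
  mxvec (map_mx (fun b : bool => b%:R) (graph_mx A)) 0.
have monov l : monomial 1 (fun A => v A l).
  case/mxvec_indexP: l => a b.
  have vE A : v A (mxvec_index a b) = (graph_mx A a b)%:R.
    by rewrite /v mxvecE mxE.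
  case ab: (insub (a, b) : option edge) => [e|].
    exists 1, [set e]; rewrite cards1; split=> // A.
    by rewrite vE big_set1 mul1r mxE ab.
  case ba: (insub (b, a) : option edge) => [e|].
    exists 1, [set e]; rewrite cards1; split=> // A.
    by rewrite vE big_set1 mul1r mxE ab ba.
  exists 0, set0; rewrite cards0; split=> // A.
  by rewrite vE mul0r mxE ab ba.
have [|c [cD cE]] := @low_degree_sum R edge D _ (msupp (P i j))
    (fun mn => (P i j)@_mn) mdeg (fun mn A => \prod_l v A l ^+ mn l).
  move=> mn mP; split.
    by rewrite -ltnS (leq_trans (msize_mdeg_lt mP)).
  rewrite mdegE; apply: monomial_prod => l.
  by rewrite -{1}[mn l]mul1n; apply: (monomialX (mn l) (monov l)).
by exists c; split=> // A; rewrite -cE mxE mevalE.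
Qed.

End Edges.

(** * From a single entry to the infimum of the risk *)

Local Open Scope classical_set_scope.

Theorem theorem2 (R : realType) (n k D : nat) (p q r : R)
    (hn : (2 <= n)%N) (hk : (1 <= k)%N) (hD : (1 <= D)%N)
    (hq : 0 < q) (hqp : q < p) (hp : p < 1)
    (hr0 : 0 < r) (hr1 : r < 1)
    (hsnr : (p - q) ^+ 2 / (q * (1 - p))
            <= r / (D%:R * (D%:R + 1)) ^+ 2 * Num.min (k%:R ^+ 2 / n%:R) 1) :
  inf [set sbm_risk k p q P | P in @poly_estimators R n D]
  >= (p - q) ^+ 2 / k%:R
     - (p - q) ^+ 2
       * (1 / k%:R ^+ 2 + r * (2 - r) / ((1 - r) ^+ 2 * n%:R)).
Proof.
case: k hk hsnr => // k _ hsnr.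
set bound := (X in X <= _).
(* The set of risks has to be nonempty; the zero estimator supplies a member. *)
apply: lb_le_inf.
  pose P0 : 'M[{mpoly R[n * n]}]_n := 0.
  by exists (sbm_risk k.+1 p q P0), P0 => // i j; rewrite mxE msize0.
move=> _ [P PD <-].
(* The loss is an average over pairs i < j, so it is enough to bound the risk of each entry by the
   same number. *)
have edge_risk (e : edge n) : bound <= \sum_(z : {ffun 'I_n -> 'I_k.+1})
    uniform_labels_pmf R z * \sum_A adjacency_pmf (sbm_mean p q z) A
      * (poly_estimate P A (edge_src e) (edge_tgt e)
         - sbm_mean p q z (edge_src e) (edge_tgt e)) ^+ 2.
  have hsnr' : (p - q) ^+ 2 / (q * (1 - p))
      <= r / (D%:R * (D%:R + 1)) ^+ 2
         * Num.min (k.+1%:R ^+ 2 / #|'I_n|%:R) 1 by rewrite card_ord.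
  have := low_degree_risk e (@edge_loopless n) (@card_inner_edges n)
    hq hqp hp hD hr0 hr1 hsnr'
    (poly_estimate_low_degree (PD (edge_src e) (edge_tgt e))).
  rewrite card_ord -/bound => /le_trans; apply.
  rewrite le_eqVlt big_distrr; apply/orP; left; apply/eqP.
  apply: eq_bigr => z _ /=; congr (_ * _).
    by rewrite /uniform_labels_pmf prodr_const card_coloring natrX exprVn.
  have meanE e' : sbm_mean p q z (edge_src e') (edge_tgt e')
      = if same (@edge_src n) (@edge_tgt n) z e' then p else q.
    by rewrite mxE (negbTE (edge_loopless e')).
  rewrite adjacency_sum meanE -(observed_law p q _ (fun A =>
    (poly_estimate P (graph_mx A) (edge_src e) (edge_tgt e) - _) ^+ 2)).
  apply: eq_bigr => A _; congr (_ * _); apply: eq_bigr => e' _.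
  by rewrite meanE.
have C0 : 0 < 'C(n, 2)%:R :> R by rewrite ltr0n bin_gt0.
suff -> : sbm_risk k.+1 p q P = 'C(n, 2)%:R^-1 * \sum_(e : edge n)
    \sum_(z : {ffun 'I_n -> 'I_k.+1})
    uniform_labels_pmf R z * \sum_A adjacency_pmf (sbm_mean p q z) A
      * (poly_estimate P A (edge_src e) (edge_tgt e)
         - sbm_mean p q z (edge_src e) (edge_tgt e)) ^+ 2.
  rewrite mulrC ler_pdivlMr // -(card_edge n) mulr_natr -sumr_const.
  by apply: ler_sum => e _; apply: edge_risk.
rewrite /sbm_risk /sbm_expectation /loss exchange_big big_distrr /=.
apply: eq_bigr => z _; rewrite -big_distrr /= [RHS]mulrCA; congr (_ * _).
rewrite exchange_big big_distrr /=; apply: eq_bigr => A _.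
rewrite -big_distrr /= [RHS]mulrCA; congr (_ * (_ * _)).
exact: (big_edge _
  (fun i j => (poly_estimate P A i j - sbm_mean p q z i j) ^+ 2)).
Qed.
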